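(* If $k \geq 4$ is an integer, then $\phi_k(T) \leq 4$ and $\phi'_k(T) \leq 4$ for every tree $T$.
   Context: Graphs are finite, simple and undirected. For $k\geq 2$, a $k$-anagram is a word $W_1W_2\cdots W_k$ where each $W_i$ is a permutation of one common non-empty word $W$ (i.e. each symbol occurs equally often in all the $W_i$). A vertex (respectively edge) colouring of a graph $G$ is a function from $V(G)$ (respectively $E(G)$) to a set of colours (no properness is assumed). A vertex (respectively edge) colouring of $G$ is $k$-anagram-free if for every path that is a subgraph of $G$, the sequence of colours of the vertices (respectively edges) along the path is not a $k$-anagram. The $k$-anagram-free chromatic number $\phi_k(G)$ is the minimum number of colours in a $k$-anagram-free vertex colouring of $G$, and the $k$-anagram-free chromatic index $\phi'_k(G)$ is the minimum number of colours in a $k$-anagram-free edge colouring of $G$. *)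

(* Defs.v *)
(* MathComp; [boolp] is used only to turn propositions into booleans. *)
From HB Require Import structures.
From mathcomp Require Import all_boot.
From mathcomp Require Import boolp.

Set Implicit Arguments.
Unset Strict Implicit.
Unset Printing Implicit Defensive.

Definition is_anagram (C : eqType) (k : nat) (w : seq C) : Prop :=
  exists (W : seq C) (Ws : seq (seq C)),
    [/\ W <> [::], size Ws = k, all (perm_eq W) Ws & w = flatten Ws].

Record sgraph := SGraph {
  vertex :> finType;
  adj : rel vertex;
  adj_sym : symmetric adj;
  adj_irrefl : irreflexive adj }.

Definition edge_set (G : sgraph) : {set {set G}} :=
  [set [set xy.1; xy.2] | xy : G * G & adj xy.1 xy.2].

Definition edge (G : sgraph) := {e : {set G} | e \in edge_set G}.

(* The sequence x :: p lists the vertices of a path that is a subgraph of G. *)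
Definition is_path (G : sgraph) (x : G) (p : seq G) : bool :=
  path (@adj G) x p && uniq (x :: p).

(* [pmap insub] only moves the pairs of consecutive vertices into the type of
   edges; on a path it drops nothing, see [val_path_edges]. *)
Definition path_edges (G : sgraph) (x : G) (p : seq G) : seq (edge G) :=
  pmap insub (pairmap (fun y z => [set y; z]) x p).

Definition vertex_anagram_free (G : sgraph) (C : eqType) (k : nat)
    (c : G -> C) : Prop :=
  forall (x : G) (p : seq G), is_path x p -> ~ is_anagram k (map c (x :: p)).

Definition edge_anagram_free (G : sgraph) (C : eqType) (k : nat)
    (c : edge G -> C) : Prop :=
  forall (x : G) (p : seq G),
    is_path x p -> ~ is_anagram k (map c (path_edges x p)).

Definition vertex_colourable (k : nat) (G : sgraph) (n : nat) : Prop :=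
  exists c : G -> 'I_n, vertex_anagram_free k c.

Definition edge_colourable (k : nat) (G : sgraph) (n : nat) : Prop :=
  exists c : edge G -> 'I_n, edge_anagram_free k c.

Definition acyclic (G : sgraph) : Prop :=
  forall s : seq G, 3 <= size s -> ~ ucycle (@adj G) s.

Definition is_tree (G : sgraph) : Prop :=
  [/\ 0 < #|G|, forall x y : G, connect (@adj G) x y & acyclic G].

Lemma val_path_edges (G : sgraph) (x : G) (p : seq G) : path (@adj G) x p ->
  map val (path_edges x p) = pairmap (fun y z => [set y; z]) x p.
Proof.
rewrite /path_edges; elim: p x => //= y p IHp x /andP[xy yp].
have xyE : [set x; y] \in edge_set G by apply/imsetP; exists (x, y); rewrite ?inE.
by rewrite insubT /= IHp.
Qed.

Lemma uniq_path_edges (G : sgraph) (x : G) (p : seq G) :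
  is_path x p -> uniq (path_edges x p).
Proof.
case/andP=> xp; rewrite -(map_inj_uniq val_inj) val_path_edges // => {xp}.
have sub (y : G) q e z : e \in pairmap (fun u v => [set u; v]) y q ->
    z \in e -> z \in y :: q.
  elim: q y => //= v q IHq y; rewrite inE => /orP[/eqP-> | /IHq vq /vq].
    by rewrite !inE => /orP[] ->; rewrite ?orbT.
  by rewrite !inE => ->; rewrite orbT.
elim: p x => //= y p IHp x /andP[xNp uyp]; rewrite IHp //= andbT.
by apply: contra xNp => /sub; apply; rewrite !inE eqxx.
Qed.

Lemma uniq_not_anagram (C : eqType) (k : nat) (w : seq C) :
  2 <= k -> uniq w -> ~ is_anagram k w.
Proof.
move=> k2 uw [[|a W] [Ws [Wn0 szWs WsP wE]]] //; rewrite -szWs in k2.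
case: Ws k2 {szWs} WsP wE => [|W1 [|W2 Ws]] // _ WsP wE.
move: WsP uw => /= /and3P[/perm_mem W1P /perm_mem W2P _].
rewrite wE /= cat_uniq => /and3P[_ /hasPn/(_ a)].
by rewrite mem_cat -W1P -W2P mem_head => /(_ isT).
Qed.

Lemma vertex_colourable_ex (k : nat) (G : sgraph) :
  2 <= k -> exists n, `[< vertex_colourable k G n >].
Proof.
move=> k2; exists #|G|; apply/asboolP; exists enum_rank => x p /andP[_ xp].
by apply: uniq_not_anagram => //; rewrite map_inj_uniq //; apply: enum_rank_inj.
Qed.

Lemma edge_colourable_ex (k : nat) (G : sgraph) :
  2 <= k -> exists n, `[< edge_colourable k G n >].
Proof.
move=> k2; exists #|{: edge G}|; apply/asboolP; exists enum_rank => x p xp.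
apply: uniq_not_anagram => //; rewrite map_inj_uniq ?uniq_path_edges //.
exact: enum_rank_inj.
Qed.

(* The hypothesis 2 <= k guarantees that the minimum exists: a colouring that
   gives each vertex (edge) its own colour is then k-anagram-free. *)
Definition anagram_free_chromatic_number (k : nat) (k2 : 2 <= k)
    (G : sgraph) : nat :=
  ex_minn (vertex_colourable_ex G k2).

Definition anagram_free_chromatic_index (k : nat) (k2 : 2 <= k)
    (G : sgraph) : nat :=
  ex_minn (edge_colourable_ex G k2).

Lemma leq4_leq2 (k : nat) : 4 <= k -> 2 <= k.
Proof. exact: leq_trans. Qed.

(* Main.v *)
Require Import Defs.
From Stdlib Require Import ZArith.
From HB Require Import structures.
From mathcomp Require Import all_boot.
From mathcomp Require Import boolp.
From mathcomp Require Import zify.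

Set Implicit Arguments.
Unset Strict Implicit.
Unset Printing Implicit Defensive.

(** Root the tree and colour each vertex by the letter [w_d], where [d] is its
depth and [w] is a long word over four letters without abelian squares, that
is, without two consecutive non-empty blocks that are permutations of each
other. A path of a tree first climbs towards the root and then descends, so
its colour sequence is a factor of [w] read backwards followed by a factor of
[w] read forwards. If it were a k-anagram with [4 <= k], then the turning
point would leave two of the first four blocks, either the first two or the
third and fourth, entirely on one side of it, and these two blocks would form
an abelian square of [w] ([valley_not_anagram]). Edges are coloured in the same
way by the depth of their lower endpoint. Only the following facts about trees
are used ([tree_levels]): depths of neighbours differ by one, and a vertex has
at most one neighbour above it; both come from the uniqueness of paths in an
acyclic graph.

Such words [w] of every length exist by a theorem of Keranen: the 85-uniform
morphism [keranen] on {0, 1, 2, 3} sends abelian-square-free words to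
abelian-square-free words, so its iterates on the word 0 are as required.
An abelian square in [keranen w] is given by three cut points, and each cut
point lies in the image [block c] of some letter [c] of [w]. The square
condition says that an integer combination of the letter counts of the three
prefixes of blocks so cut off lies in the lattice spanned by the letter counts
of the blocks. For this morphism very few triples of cut blocks meet this
condition, and for each of them the three cut points can be moved to an end of
the block that they cut without destroying the balance of the letter counts
([shiftableP]). The moved cut points come from cut points of [w], and they
delimit an abelian square there because the matrix of the morphism is
invertible ([count_keranen_inj]). *)

(** * Abelian-square-free words *)

Definition abelian_square_free (C : eqType) (s : seq C) : Prop :=
  forall u v : seq C, infix (u ++ v) s -> perm_eq u v -> u = [::].

Lemma count_mem_perm (C : eqType) (s t : seq C) :
  (forall x, count_mem x s = count_mem x t) -> perm_eq s t.
Proof. by move=> eq_st; apply/allP=> x _ /=; rewrite eq_st. Qed.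

(** An abelian square is recorded by its three cut points: the letter counts of
the prefixes that end there are in arithmetic progression. This form turns the
analysis of a morphism into linear algebra. *)
Lemma abelian_square_freeP (C : eqType) (s : seq C) :
  abelian_square_free s <->
  forall p0 p1 p2, p0 <= p1 -> p1 <= p2 -> p2 <= size s ->
    (forall x, count_mem x (take p0 s) + count_mem x (take p2 s) =
               (count_mem x (take p1 s)).*2) ->
    p0 = p1.
Proof.
split=> [asf p0 p1 p2 p01 p12 p2s cnt | asf u v /infixP[a [b sE]] uv].
  have split_take i j : i <= j -> take j s = take i s ++ drop i (take j s).
    by move=> ij; rewrite -{1}(cat_take_drop i (take j s)) take_takel.
  pose u := drop p0 (take p1 s); pose v := drop p1 (take p2 s).
  have E1 := split_take _ _ p01; have E2 := split_take _ _ p12.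
  have u0 : u = [::].
    apply: (asf u v).
      apply/infixP; exists (take p0 s), (drop p2 s).
      by rewrite -catA catA -E1 catA -E2 cat_take_drop.
    apply: count_mem_perm => x; move: (cnt x).
    rewrite (congr1 (count_mem x) E2) count_cat.
    rewrite (congr1 (count_mem x) E1) count_cat -/u -/v; lia.
  have := size_drop p0 (take p1 s); rewrite -/u u0 size_takel /=; lia.
have E t t' : a ++ (u ++ v) ++ b = t ++ t' -> take (size t) s = t.
  by move=> sE'; rewrite sE sE' take_size_cat.
have E0 := E a ((u ++ v) ++ b) erefl.
have E1 : take (size (a ++ u)) s = a ++ u.
  by apply: (E _ (v ++ b)); rewrite !catA.
have E2 : take (size (a ++ u ++ v)) s = a ++ u ++ v.
  by apply: (E _ b); rewrite !catA.
have := asf (size a) (size (a ++ u)) (size (a ++ u ++ v)).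
rewrite E0 E1 E2 sE !size_cat => H.
apply: size0nil; suff : size a = size a + size u by lia.
by apply: H => [|||x]; rewrite ?count_cat -?(permP uv); lia.
Qed.

(** * Keranen's morphism *)

Definition keranen_base : seq nat :=
  [:: 0; 1; 2; 0; 2; 3; 2; 1; 2; 3; 2; 0; 3; 2; 3; 1; 3; 0; 1; 0; 2; 0; 1; 0; 3;
      1; 0; 1; 2; 1; 3; 1; 2; 1; 0; 2; 1; 2; 3; 2; 0; 2; 1; 0; 1; 3; 0; 1; 0; 2;
      0; 3; 2; 1; 2; 3; 2; 0; 2; 3; 1; 2; 1; 0; 2; 1; 2; 3; 2; 0; 2; 3; 2; 1; 3;
      2; 3; 0; 3; 1; 3; 2; 1; 2; 0].

(** The blocks of the four letters differ by a cyclic shift of the alphabet.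
Letters are natural numbers, so that this is a total function that computes. *)
Definition block (c : nat) : seq nat :=
  [seq (x + c) %% 4 | x <- keranen_base].

Definition keranen (w : seq nat) : seq nat := flatten [seq block c | c <- w].

Definition block_prefix (c r : nat) : seq nat := take r (block c).

Arguments block : simpl never.
Arguments keranen : simpl never.

Lemma block_mod c : block (c %% 4) = block c.
Proof. by apply: eq_map => x; rewrite modnDmr. Qed.

Lemma size_block c : size (block c) = 85.
Proof. by rewrite size_map. Qed.

Lemma keranen_cons c w : keranen (c :: w) = block c ++ keranen w.
Proof. by []. Qed.

Lemma size_keranen w : size (keranen w) = 85 * size w.
Proof.
elim: w => [|c w IHw] //.
by rewrite keranen_cons size_cat size_block IHw /=; lia.
Qed.

Lemma keranen_lt4 w : all (gtn 4) (keranen w).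
Proof.
elim: w => // c w IHw; rewrite keranen_cons all_cat IHw andbT.
by apply/allP => _ /mapP[x _ ->]; rewrite /= ltn_mod.
Qed.

Lemma take_keranen w i r : i < size w -> r <= 85 ->
  take (85 * i + r) (keranen w) =
  keranen (take i w) ++ block_prefix (nth 0 w i) r.
Proof.
elim: w i => [|c w IHw] // [_ r85 | i iw r85]; rewrite ?keranen_cons.
  rewrite muln0 add0n take_cat size_block.
  case: ltnP => // r85'; rewrite (_ : r = 85); last by lia.
  by rewrite subnn !take0 cats0 /block_prefix take_oversize ?size_block.
rewrite take_cat size_block ifN -?leqNgt; last by lia.
rewrite (_ : _ - 85 = 85 * i + r); last by lia.
by rewrite IHw // catA.
Qed.

(** Moving a cut point from the inside of a block to its end adds the whole
block to the prefix, and to its start adds nothing. *)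
Lemma count_take_keranen w x i (e : bool) : i < size w ->
  count_mem x (keranen (take (i + e) w)) =
  count_mem x (keranen (take i w)) + e * count_mem x (block (nth 0 w i)).
Proof.
move=> iw; case: e; last by rewrite !addn0.
rewrite addn1 mul1n (take_nth 0) // /keranen map_rcons flatten_rcons.
exact: count_cat.
Qed.

Lemma count_keranen w x : all (gtn 4) w ->
  count_mem x (keranen w) =
    count_mem 0 w * count_mem x (block 0) +
    count_mem 1 w * count_mem x (block 1) +
    count_mem 2 w * count_mem x (block 2) +
    count_mem 3 w * count_mem x (block 3).
Proof.
elim: w => [|c w IHw] // /andP[c4 /IHw E].
have consE y : count_mem y (c :: w) = (c == y) + count_mem y w by [].
rewrite keranen_cons count_cat E !consE.
by case: c c4 {consE} => [|[|[|[|]]]] // _; lia.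
Qed.

(** The letter counts of the four blocks form a circulant matrix of determinant
85 * 511, so the counts of a word can be recovered from those of its image. *)
Lemma count_keranen_inj w0 w1 w2 :
  all (gtn 4) w0 -> all (gtn 4) w1 -> all (gtn 4) w2 ->
  (forall x, x < 4 -> count_mem x (keranen w0) + count_mem x (keranen w2) =
     (count_mem x (keranen w1)).*2) ->
  forall x, count_mem x w0 + count_mem x w2 = (count_mem x w1).*2.
Proof.
move=> a0 a1 a2 cnt x.
have [x4 | x4] := leqP 4 x.
  have no w : all (gtn 4) w -> count_mem x w = 0.
    move=> /allP aw; apply/count_memPn/negP=> /aw /=; lia.
  by rewrite !no.
have blockE y : y < 4 ->
    [/\ count_mem 0 (block y) = nth 0 [:: 19; 18; 27; 21] y,
        count_mem 1 (block y) = nth 0 [:: 21; 19; 18; 27] y,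
        count_mem 2 (block y) = nth 0 [:: 27; 21; 19; 18] y &
        count_mem 3 (block y) = nth 0 [:: 18; 27; 21; 19] y].
  by case: y => [|[|[|[|]]]].
move: (cnt 0 isT) (cnt 1 isT) (cnt 2 isT) (cnt 3 isT).
rewrite !count_keranen //.
have [-> -> -> ->] := blockE 0 isT; have [-> -> -> ->] := blockE 1 isT.
have [-> -> -> ->] := blockE 2 isT; have [-> -> -> ->] := blockE 3 isT.
rewrite /= => E0 E1 E2 E3.
by case: x x4 => [|[|[|[|]]]] // _; lia.
Qed.

(** * A linear invariant that vanishes on all blocks *)

(** The weights are the powers of 27 modulo 511. As 27 is a fourth root of unity
modulo 511, shifting the alphabet multiplies [hash] by a power of 27 modulo
511, and 27 is also a root of the polynomial [19 + 21 t + 27 t^2 + 18 t^3] of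
the letter counts of [keranen_base]; so [hash] is divisible by 511 on every
block. Together with the length modulo 85, it detects exactly the lattice
spanned by the letter counts of the blocks. *)
Definition weight (x : nat) : Z := nth 0%Z [:: 1; 27; 218; 265]%Z x.

Definition hash (s : seq nat) : Z :=
  foldr (fun x => Z.add (weight x)) 0%Z s.

Local Arguments Z.add : simpl never.
Local Arguments Z.mul : simpl never.
Local Arguments Z.of_nat : simpl never.

Lemma hashE s : hash s =
  (Z.of_nat (count_mem 0%N s) + 27 * Z.of_nat (count_mem 1%N s) +
   218 * Z.of_nat (count_mem 2%N s) + 265 * Z.of_nat (count_mem 3%N s))%Z.
Proof.
elim: s => //= x s ->.
by case: x => [|[|[|[|x]]]] /=; rewrite /weight /= ?nth_nil; lia.
Qed.

Lemma hash_cat s t : hash (s ++ t) = (hash s + hash t)%Z.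
Proof. by rewrite !hashE !count_cat; lia. Qed.

Lemma hash_keranen w : exists k, hash (keranen w) = (511 * k)%Z.
Proof.
elim: w => [|c w [k IHw]]; first by exists 0%Z.
have [l hl] : exists l, hash (block c) = (511 * l)%Z.
  exists (hash (block c) / 511)%Z; apply/Z.eqb_spec.
  have : c %% 4 < 4 by rewrite ltn_mod.
  by rewrite -(block_mod c); case: (c %% 4) => [|[|[|[|]]]] // _; vm_compute.
by exists (l + k)%Z; rewrite keranen_cons hash_cat IHw hl; lia.
Qed.

(** * Moving cut points to the ends of blocks *)

(** The cut points of an abelian square are distinct, but might become equal
once moved. If [i0 <= i1 <= i2] are the indices of the blocks that they cut, the
moved cut points are at [i0 + e0], [i1 + e1] and [i2 + e2]. The first two
coincide in two cases only. Either [i0 = i1] and [e0 = e1], and then [i2] is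
[i1], or [i2] is [i1 + 1] and its block is cut at a smaller offset; or
[i1 = i0 + 1], [e0] and [~~ e1], and then [i2 = i1] as the moved cut points are
equidistant. The two disjuncts are what these two cases say about the letters
and offsets. *)
Definition degenerate (c0 c1 c2 r0 r1 r2 : nat) (e0 e1 : bool) : bool :=
  [&& c0 == c1, r0 < r1, e0 == e1 & (c1 == c2) || (r2 < r1)]
  || [&& c1 == c2, r1 < r2, e0 & ~~ e1].

(** The cut at offset [r] of [block c] is moved to the end of the block if [e]
and to its start otherwise; the equation says that the three changes of letter
counts cancel out in the square condition. *)
Definition balanced_shift (c0 c1 c2 r0 r1 r2 : nat) (e0 e1 e2 : bool) : bool :=
  all (fun x =>
    count_mem x (block_prefix c0 r0) + count_mem x (block_prefix c2 r2) +
      (e1 * count_mem x (block c1)).*2 ==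
    (count_mem x (block_prefix c1 r1)).*2 +
      e0 * count_mem x (block c0) + e2 * count_mem x (block c2)) (iota 0 4)
  && ~~ degenerate c0 c1 c2 r0 r1 r2 e0 e1.

Definition shiftable (c0 c1 c2 r0 r1 r2 : nat) : bool :=
  let bools := [:: false; true] in
  has (fun e0 => has (fun e1 => has (fun e2 =>
    balanced_shift c0 c1 c2 r0 r1 r2 e0 e1 e2) bools) bools) bools.

Definition residue (c r : nat) : Z := (hash (block_prefix c r) mod 511)%Z.

Definition residue_column (r : nat) : seq Z :=
  [seq residue c r | c <- iota 0 4].

Definition residue_columns : seq (seq Z) :=
  [seq residue_column r | r <- iota 0 86].

(** The two halves of a square have equal length, which determines [r2] from
[r0] and [r1]. A first or middle cut at a block boundary is read as an offset 0
and a last cut as an offset 85, so that all three blocks exist even at the end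
of the word. The conditional, unlike an implication, evaluates [shiftable] only
on the few triples that pass the test on residues. *)
Definition all_shiftable : bool :=
  let columns := residue_columns in
  all (fun r0 => all (fun r1 =>
    let r2 := ((r1.*2 + 84 - r0) %% 85).+1 in
    let column0 := nth [::] columns r0 in
    let column1 := nth [::] columns r1 in
    let column2 := nth [::] columns r2 in
    all (fun c0 => all (fun c1 =>
      let h1 := nth 0%Z column1 c1 in
      let h2 := ((h1 + h1 - nth 0%Z column0 c0) mod 511)%Z in
      all (fun c2 => if Z.eqb h2 (nth 0%Z column2 c2)
                     then shiftable c0 c1 c2 r0 r1 r2 else true)
    (iota 0 4)) (iota 0 4)) (iota 0 4)) (iota 0 85)) (iota 0 85).

Lemma all_shiftableT : all_shiftable.
Proof. by vm_compute. Qed.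

(** A square condition modulo the images of whole blocks, which is what [hash]
and the formula for [r2] express, forces a harmless move of the cut points. Of
the 85 * 85 * 4^3 triples of cut blocks with offsets related by this formula,
only 1420 satisfy the congruence, and evaluation checks them all. *)
Lemma shiftableP c0 c1 c2 r0 r1 r2 k :
  c0 < 4 -> c1 < 4 -> c2 < 4 -> r0 < 85 -> r1 < 85 ->
  r2 = ((r1.*2 + 84 - r0) %% 85).+1 ->
  (hash (block_prefix c0 r0) + hash (block_prefix c2 r2) =
   2 * hash (block_prefix c1 r1) + 511 * k)%Z ->
  exists e0 e1 e2, balanced_shift c0 c1 c2 r0 r1 r2 e0 e1 e2.
Proof.
move=> c04 c14 c24 r085 r185 r2E hk.
have columnsE c r : c < 4 -> r < 86 ->
    nth 0%Z (nth [::] residue_columns r) c = residue c r.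
  by move=> c4 r86; rewrite !(nth_map 0) ?size_iota ?nth_iota.
have allE P n i : all P (iota 0 n) -> i < n -> P i.
  by move=> /allP Pn ilt; apply: Pn; rewrite mem_iota.
have /allE/(_ r085)/allE/(_ r185) := all_shiftableT; rewrite -r2E.
move=> /allE/(_ c04)/allE/(_ c14)/allE/(_ c24).
rewrite !columnsE //; try by have := ltn_mod (r1.*2 + 84 - r0) 85; lia.
have -> : Z.eqb ((residue c1 r1 + residue c1 r1 - residue c0 r0) mod 511)%Z
                (residue c2 r2).
  apply/Z.eqb_spec; rewrite /residue Zminus_mod Zmod_mod -Zplus_mod -Zminus_mod.
  rewrite (_ : _ - _ = hash (block_prefix c2 r2) + (- k) * 511)%Z; last by lia.
  by rewrite Z_mod_plus_full.
by case/hasP=> e0 _ /hasP[e1 _ /hasP[e2 _ H]]; exists e0, e1, e2.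
Qed.

(** * Arbitrarily long abelian-square-free words *)

(** The cut points [p0 < p1 < p2] of a square in [keranen w] are written as
[85 * i + r]. Since [hash] is divisible by 511 on images, the square condition
restricts to a congruence between the hashes of the three cut off prefixes of
blocks, so that [shiftableP] provides a square in [w]. *)
Lemma keranen_abelian_square_free w :
  all (gtn 4) w -> abelian_square_free w -> abelian_square_free (keranen w).
Proof.
move=> w4 /abelian_square_freeP asf; apply/abelian_square_freeP.
move=> p0 p1 p2 p01 p12; rewrite size_keranen => p2w cnt.
apply/eqP; rewrite eqn_leq p01 leqNgt; apply/negP => {p01} p01.
have p_sum : p0 + p2 = p1.*2.
  have /perm_size : perm_eq (take p0 (keranen w) ++ take p2 (keranen w))
                            (take p1 (keranen w) ++ take p1 (keranen w)).
    by apply: count_mem_perm => x; rewrite !count_cat cnt addnn.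
  by rewrite !size_cat !size_takel ?size_keranen; lia.
pose i0 := p0 %/ 85; pose r0 := p0 %% 85.
pose i1 := p1 %/ 85; pose r1 := p1 %% 85.
pose i2 := p2.-1 %/ 85; pose r2 := (p2.-1 %% 85).+1.
have p0E : p0 = 85 * i0 + r0 by rewrite mulnC; exact: divn_eq.
have p1E : p1 = 85 * i1 + r1 by rewrite mulnC; exact: divn_eq.
have p2E : p2 = 85 * i2 + r2 by have := divn_eq p2.-1 85; rewrite -/i2; lia.
have r085 : r0 < 85 by rewrite ltn_mod.
have r185 : r1 < 85 by rewrite ltn_mod.
have r285 : r2 <= 85 by rewrite ltn_mod.
have r2gt0 : 0 < r2 by [].
have r2E : r2 = ((r1.*2 + 84 - r0) %% 85).+1 by lia.
clearbody i0 i1 i2 r0 r1 r2; subst p0 p1 p2.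
have i0w : i0 < size w by lia.
have i1w : i1 < size w by lia.
have i2w : i2 < size w by lia.
set c0 := nth 0 w i0; set c1 := nth 0 w i1; set c2 := nth 0 w i2.
have nth4 i : i < size w -> nth 0 w i < 4 by move=> iw; apply: (all_nthP 0 w4).
have cntE x :
    count_mem x (keranen (take i0 w)) + count_mem x (block_prefix c0 r0) +
    (count_mem x (keranen (take i2 w)) + count_mem x (block_prefix c2 r2)) =
    (count_mem x (keranen (take i1 w)) + count_mem x (block_prefix c1 r1)).*2.
  have := cnt x; rewrite !take_keranen ?(ltnW r085) ?(ltnW r185) //.
  by rewrite !count_cat -/c0 -/c1 -/c2.
have [k hk] : exists k,
  (hash (block_prefix c0 r0) + hash (block_prefix c2 r2) =
   2 * hash (block_prefix c1 r1) + 511 * k)%Z.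
  have [k0 h0] := hash_keranen (take i0 w).
  have [k1 h1] := hash_keranen (take i1 w).
  have [k2 h2] := hash_keranen (take i2 w).
  exists (2 * k1 - k0 - k2)%Z; move: h0 h1 h2; rewrite !hashE.
  by move: (cntE 0) (cntE 1) (cntE 2) (cntE 3); lia.
have [] := shiftableP _ _ _ r085 r185 r2E hk; rewrite ?nth4 //.
move=> e0 [e1 [e2 /andP[/allP cntL ndeg]]].
have take4 i : all (gtn 4) (take i w).
  by move: w4; rewrite -{1}(cat_take_drop i w) all_cat => /andP[].
pose j0 := i0 + e0; pose j1 := i1 + e1; pose j2 := i2 + e2.
have [j0w j1w j2w] : [/\ j0 <= size w, j1 <= size w & j2 <= size w].
  by rewrite /j0 /j1 /j2; split; lia.
have cntJ x : count_mem x (take j0 w) + count_mem x (take j2 w) =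
              (count_mem x (take j1 w)).*2.
  apply: count_keranen_inj x => // x x4.
  rewrite !count_take_keranen //.
  have := cntL x; rewrite mem_iota => /(_ x4)/eqP.
  by have := cntE x; rewrite -/c0 -/c1 -/c2; lia.
have j_sum : j0 + j2 = j1.*2.
  have /perm_size : perm_eq (take j0 w ++ take j2 w) (take j1 w ++ take j1 w).
    by apply: count_mem_perm => x; rewrite !count_cat cntJ addnn.
  by rewrite !size_cat !size_takel // addnn.
have j01 : j0 = j1 by apply: asf cntJ; rewrite // /j0 /j1 /j2 in j_sum *; lia.
case/negP: ndeg; rewrite /degenerate; apply/orP.
have [[i01 e01] | [i01 [e0T e1F]]] :
    i0 = i1 /\ e0 = e1 \/ i1 = i0.+1 /\ e0 /\ ~~ e1.
  by move: j01; rewrite /j0 /j1; case: (e0) (e1) => [] [] /=; lia.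
- left; rewrite e01 /c0 i01 !eqxx /=; apply/andP; split; first by lia.
  have [i21 | i12] := eqVneq i2 i1; first by rewrite /c2 i21 eqxx.
  by rewrite (_ : r2 < r1) ?orbT //; lia.
- right; rewrite e0T e1F !andbT.
  have i21 : i2 = i1 by lia.
  by rewrite /c2 i21 eqxx /=; lia.
Qed.

Lemma long_abelian_square_free n :
  exists w, [/\ n < size w, all (gtn 4) w & abelian_square_free w].
Proof.
elim: n => [|n [w [nw w4 asf]]].
  exists [:: 0]; split=> // -[|x u] [|y v] /size_infix //=.
  - by move=> _ /perm_size.
  - by rewrite size_cat /= addnS.
exists (keranen w); rewrite keranen_lt4 size_keranen; split=> //; first by lia.
exact: keranen_abelian_square_free.
Qed.

(** * Anagrams on words that turn once *)

(** If the factor read backwards is at least as long as the first two blocks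
[V1] and [V2] of the anagram, it contains them, and otherwise the factor read
forwards contains the blocks [V3] and [V4]. In the first case reversal turns
[V1 ++ V2] into the square [rev V2 ++ rev V1] of [w]. *)
Lemma valley_not_anagram (C : eqType) (x0 : C) (w : seq C) k a b m n :
  4 <= k -> abelian_square_free w -> a + m <= size w -> b + n <= size w ->
  ~ is_anagram k (map (nth x0 w) (rev (iota a m) ++ iota b n)).
Proof.
move=> k4 asf am bn [W [Ws [W0 szWs perms E]]].
case: Ws szWs perms E => [|V1 [|V2 [|V3 [|V4 Ws]]]] /= szWs;
  try by rewrite -szWs in k4.
case/and5P=> WV1 WV2 WV3 WV4 _.
rewrite map_cat map_rev !map_nth_iota; try lia.
set s := take m _; set t := take n _ => E.
have sw : infix s w by apply: infix_trans (infix_take _ _) (infix_drop _ _).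
have tw : infix t w by apply: infix_trans (infix_take _ _) (infix_drop _ _).
have square U V r :
    infix (U ++ V) r -> infix r w -> perm_eq W U -> perm_eq W V -> False.
  move=> UV rw WU WV; have U0 : U = [::].
    by apply: asf (infix_trans UV rw) _; rewrite -(permPl WU).
  by apply/W0/perm_nilP; rewrite -U0.
have [ms | sm] := leqP (size (V1 ++ V2)) (size s).
  apply: (square (rev V2) (rev V1) s) => //; rewrite ?perm_rev //.
  - rewrite -rev_cat infix_revLR; apply: prefixW; rewrite prefixE.
    have := congr1 (take (size (V1 ++ V2))) E.
    rewrite takel_cat ?size_rev // => ->.
    by rewrite catA take_size_cat.
  - by rewrite perm_sym perm_rev perm_sym.
  - by rewrite perm_sym perm_rev perm_sym.
apply: (square V3 V4 t) => //.
have := congr1 (drop (size s)) E.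
rewrite drop_cat size_rev ltnn subnn drop0 => ->.
rewrite catA drop_cat sm catA; apply/infixP.
by exists (drop (size s) (V1 ++ V2)), (flatten Ws); rewrite -!catA.
Qed.

Lemma is_anagram_map (C D : eqType) (f : C -> D) k s :
  is_anagram k s -> is_anagram k (map f s).
Proof.
case=> W [Ws [W0 szWs perms ->]]; exists (map f W), (map (map f) Ws).
split; rewrite ?size_map ?map_flatten //; first by case: W W0 {perms}.
by rewrite all_map; apply: sub_all perms => V /=; apply: perm_map.
Qed.

(** * Levels of a tree *)

(** If two paths with the same ends leave [x] through different neighbours [a]
and [b], then their remainders connect [a] to [b] in the graph without [x], and
a simple path from [a] to [b] there closes up to a cycle through [x]. *)
Lemma acyclic_uniq_path (T : sgraph) (acyT : acyclic T) (x : T) (p q : seq T) :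
  is_path x p -> is_path x q -> last x p = last x q -> p = q.
Proof.
elim: p q x => [|a p IHp] [|b q] x //.
- by move=> _ /andP[_ /andP[xNq _]] /= xE; rewrite xE mem_last in xNq.
- by move=> /andP[_ /andP[xNp _]] _ /= xE; rewrite -xE mem_last in xNp.
move=> /andP[/= /andP[xa ap] /and3P[xNp aNp up]].
move=> /andP[/= /andP[xb bq] /and3P[xNq bNq uq]] pq.
have [ab | ab] := eqVneq a b.
  by subst b; rewrite (IHp q a) // /is_path /= ?ap ?aNp ?bq ?bNq.
pose e' := [rel y z : T | [&& adj y z, y != x & z != x]].
have sube' y r : x != y -> path e' y r = path (@adj T) y r && (x \notin r).
  elim: r y => //= z r IHr y xy; rewrite inE negb_or eq_sym xy /= eq_sym.
  by have [-> | xz] := eqVneq x z; rewrite ?andbF // IHr // !andbT andbA.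
have sym_e' : connect_sym e'.
  by apply: sym_connect_sym => y z /=; rewrite adj_sym [(y != x) && _]andbC.
have [xa' xp] : x != a /\ x \notin p.
  by move: xNp; rewrite inE negb_or => /andP[].
have [xb' xq] : x != b /\ x \notin q.
  by move: xNq; rewrite inE negb_or => /andP[].
have : connect e' a b.
  apply: (@connect_trans _ _ (last a p)).
    by apply/connectP; exists p; rewrite // sube' // ap.
  by rewrite sym_e' pq; apply/connectP; exists q; rewrite // sube' // bq.
case/connectP=> r0 /shortenP[r ar ur _] bE.
have /(acyT [:: x, a & r]) [] : 3 <= size [:: x, a & r].
  by case: r bE {ar ur} => //= bE; rewrite bE eqxx in ab.
move: ar; rewrite sube' // => /andP[ar xr].
rewrite /ucycle /= rcons_path -bE [adj b x]adj_sym xa xb ar.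
by rewrite inE negb_or xa' xr.
Qed.

Lemma connect_is_path (T : sgraph) (x y : T) :
  connect (@adj T) x y -> exists p, is_path x p /\ last x p = y.
Proof.
by case/connectP=> p0 /shortenP[p xp up _] ->; exists p; rewrite /is_path xp.
Qed.

Record level_function (T : sgraph) (d : T -> nat) : Prop := {
  level_adj : forall x y, adj x y -> d x = (d y).+1 \/ d y = (d x).+1;
  parent_uniq : forall x y z, adj y x -> adj y z ->
    d y = (d x).+1 -> d y = (d z).+1 -> x = z }.

(** The level of [y] is the length of the unique path from the root to [y]; for
adjacent vertices, one of these two paths extends the other by one edge. *)
Lemma tree_levels (T : sgraph) : is_tree T ->
  exists2 d : T -> nat, level_function d & forall x, d x < #|T|.
Proof.
case=> /card_gt0P[r _] conT acyT.
have exP y : exists p, is_path r p && (last r p == y).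
  have [p [rp <-]] := connect_is_path (conT r y).
  by exists p; rewrite rp eqxx.
pose P y := xchoose (exP y).
have pathP y : is_path r (P y) by have /andP[] := xchooseP (exP y).
have lastP y : last r (P y) = y by have /andP[_ /eqP] := xchooseP (exP y).
have P_uniq p : is_path r p -> P (last r p) = p.
  by move=> rp; apply: (acyclic_uniq_path acyT (pathP _) rp); rewrite lastP.
have P_rcons x y : adj x y -> y \notin r :: P x -> P y = rcons (P x) y.
  move=> xy yNP; rewrite -[y in LHS](last_rcons r (P x)); apply: P_uniq.
  have /andP[rPx uPx] := pathP x.
  by rewrite /is_path rcons_path rPx lastP xy -rcons_cons rcons_uniq yNP.
have step x y : adj x y -> P x = rcons (P y) x \/ P y = rcons (P x) y.
  move=> xy; have [yP | yNP] := boolP (y \in r :: P x); last first.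
    by right; apply: P_rcons.
  have [p1 [p2 [PxE y1]]] : exists p1 p2, P x = p1 ++ p2 /\ last r p1 = y.
    by case/splitPl: yP => p1 p2 y1; exists p1, p2.
  have := pathP x; rewrite {1}PxE /is_path cat_path -cat_cons cat_uniq.
  move=> /andP[/andP[rp1 _] /and3P[up1 /hasPn p12 _]].
  have PyE : P y = p1 by rewrite -y1; apply: P_uniq; rewrite /is_path rp1.
  left; apply: P_rcons; rewrite 1?adj_sym // PyE; apply: p12.
  have := lastP x; rewrite PxE last_cat y1.
  case: p2 {PxE} => [|z p2] /= xE; last by rewrite -xE mem_last.
  by rewrite xE adj_irrefl in xy.
exists (fun y => size (P y)) => [|x].
  split=> [x y /step[] -> | x y z yx yz]; rewrite ?size_rcons.
  - by left.
  - by right.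
  have parent t :
      adj y t -> size (P y) = (size (P t)).+1 -> P y = rcons (P t) y.
    by case/step=> // ->; rewrite size_rcons; lia.
  move=> /(parent _ yx) PyE /(parent _ yz); rewrite PyE => /rcons_inj[PE].
  by rewrite -(lastP x) PE lastP.
have /andP[_ /card_uniqP sz] := pathP x.
by rewrite (leq_trans _ (max_card (mem (r :: P x)))) // sz.
Qed.

(** A path cannot climb after a descent: the vertex where it turned would have
two neighbours above it. So it makes [m] steps up to level [a] and then [n]
steps down; the level of the lower end of an edge takes the value [a.+1] on both
edges at the turning point. *)
Lemma path_valley (T : sgraph) (d : T -> nat) x p :
  level_function d -> is_path x p -> exists a m n,
  [/\ d x = a + m, d (last x p) = a + n,
      map d (x :: p) = rev (iota a m.+1) ++ iota a.+1 n &
      pairmap (fun y z => maxn (d y) (d z)) x p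
        = rev (iota a.+1 m) ++ iota a.+1 n].
Proof.
have rev_iotaS i j : rev (iota i j.+1) = i + j :: rev (iota i j).
  by rewrite -addn1 iotaD rev_cat.
move=> lev; elim: p x => [|y p IHp] x.
  by exists (d x), 0, 0; rewrite addn0.
move=> /andP[/= /andP[xy yp] /and3P[xNp yNp up]].
have [|a [m [n [dy dl dp ep]]]] := IHp y; first by rewrite /is_path yp /= yNp.
have [dx | dx] := level_adj lev xy.
  exists a, m.+1, n; split; rewrite ?addnS -?dy //.
    by rewrite (rev_iotaS a m.+1) /= -dp addnS -dy dx.
  by rewrite (rev_iotaS a.+1 m) /= -ep (maxn_idPl _) dx // addSn -dy.
have m0 : m = 0.
  case: m dy dp {ep} => // m dy; rewrite 2!rev_iotaS.
  case: p yp xNp {IHp yNp up dl} => //= z p /andP[yz _] xNp [_ dz _].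
  suff xz : x = z by rewrite xz !inE eqxx orbT in xNp.
  by apply: (parent_uniq lev) dx _; rewrite // 1?adj_sym // dy dz addnS.
rewrite m0 addn0 in dy dp ep; subst a; rewrite /= dx in dp ep.
exists (d x), 0, n.+1; split; rewrite ?addn0 ?addnS ?dl ?dx //=.
  by rewrite dp.
by rewrite ep (maxn_idPr _).
Qed.

Lemma map_path_edges (T : sgraph) (D : Type) (f : {set T} -> D) x p :
  path (@adj T) x p ->
  map (f \o val) (path_edges x p) = pairmap (fun y z => f [set y; z]) x p.
Proof.
move=> xp; rewrite map_comp val_path_edges //.
by elim: p x {xp} => //= y p IHp x; rewrite IHp.
Qed.

Theorem theorem7 (k : nat) (k4 : 4 <= k) (T : sgraph) (treeT : is_tree T) :
  anagram_free_chromatic_number (leq4_leq2 k4) T <= 4 /\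
  anagram_free_chromatic_index (leq4_leq2 k4) T <= 4.
Proof.
have [d lev dT] := tree_levels treeT.
have [w [wT w4 asf]] := long_abelian_square_free #|T|.
have dw x : d x < size w by apply: ltn_trans (dT x) wT.
pose colour i : 'I_4 := inord (nth 0 w i).
have colourK : map (val \o colour) =1 map (nth 0 w).
  apply: eq_map => i /=; rewrite inordK //.
  have [iw | wi] := ltnP i (size w); last by rewrite nth_default.
  exact: (all_nthP 0 w4).
rewrite /anagram_free_chromatic_number /anagram_free_chromatic_index.
split; case: ex_minnP => n _; apply; apply/asboolP.
- exists (colour \o d) => x p /(path_valley lev)[a [m [l [dx dl dp _]]]].
  rewrite map_comp dp => /(is_anagram_map val); rewrite -map_comp colourK.
  apply: valley_not_anagram => //; rewrite ?addnS ?addSn -?dx -?dl; exact: dw.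
- pose colour_set (E : {set T}) := colour (\max_(x in E) d x).
  exists (colour_set \o val) => x p xp.
  have [a [m [l [dx dl _ ep]]]] := path_valley lev xp.
  have colourE y z : colour_set [set y; z] = colour (maxn (d y) (d z)).
    rewrite /colour_set; have [-> | yz] := eqVneq y z.
      by rewrite setUid big_set1 maxnn.
    by rewrite big_setU1 ?inE //= big_set1.
  rewrite map_path_edges; last by case/andP: xp.
  have -> : pairmap (fun y z => colour_set [set y; z]) x p =
            map colour (rev (iota a.+1 m) ++ iota a.+1 l).
    by rewrite -ep; elim: (p) (x) => //= z q IHq y; rewrite IHq colourE.
  move=> /(is_anagram_map val); rewrite -map_comp colourK.
  apply: valley_not_anagram => //; rewrite ?addnS ?addSn -?dx -?dl; exact: dw.
Qed.
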